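(* Let $\mathbb K$ be an infinite field and let $F=l_1\cdots l_m\in \mathbb K[x_1,\ldots,x_n]$ be the defining form of a generic hyperplane arrangement of size $m\geq n+1$, where $\mathrm{char}(\mathbb K)\nmid m$. Then the gradient ideal $J_F=\langle \partial F/\partial x_1,\ldots,\partial F/\partial x_n\rangle$ is a minimal reduction of the ideal $I=\langle F/l_1,\ldots,F/l_m\rangle$ generated by the $(m-1)$-fold products of the defining linear forms.
   Context: A generic hyperplane arrangement of size $m$ in $\mathbb K^n$ is a central arrangement of rank $n$ defined by distinct (pairwise non-proportional) linear forms $l_1,\ldots,l_m\in \mathbb K[x_1,\ldots,x_n]$ such that any $n$ of them are $\mathbb K$-linearly independent; its defining form is $F=l_1\cdots l_m$. An ideal $J\subset I$ is a reduction of $I$ if $I^{s+1}=JI^s$ for some $s\geq 0$ (equivalently, $I$ is integral over $J$); it is a minimal reduction if it contains properly no other reduction of $I$. By convention $\mathrm{char}(\mathbb K)\nmid m$ holds when $\mathrm{char}(\mathbb K)=0$. *)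

(* Defs.v *)
From HB Require Import structures.
From mathcomp Require Import all_boot all_order all_algebra.
From mathcomp Require Import mpoly.

Set Implicit Arguments.
Unset Strict Implicit.
Unset Printing Implicit Defensive.

Import GRing.Theory.
Local Open Scope ring_scope.

Definition infinite_type (T : eqType) : Prop :=
  forall s : seq T, exists x : T, x \notin s.

(* Ideals are Prop-valued predicates: membership in an ideal need not be
   decidable, so the boolean ideals of ring_quotient would be too few. *)
Section Ideals.
Variable R : comNzRingType.
Implicit Types (I J : R -> Prop) (S : R -> Prop).

Definition is_ideal I : Prop :=
  [/\ I 0, forall x y, I x -> I y -> I (x + y) & forall a x, I x -> I (a * x)].

Definition ideal_sub I J : Prop := forall x, I x -> J x.

Definition ideal_eq I J : Prop := forall x, I x <-> J x.

Definition ideal_gen S : R -> Prop := fun x =>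
  exists (k : nat) (a s : 'I_k -> R),
    (forall i, S (s i)) /\ x = \sum_(i < k) a i * s i.

Definition ideal_mul I J : R -> Prop :=
  ideal_gen (fun x => exists a b, [/\ I a, J b & x = a * b]).

Fixpoint ideal_exp I (s : nat) : R -> Prop :=
  if s is s'.+1 then ideal_mul I (ideal_exp I s') else fun _ => True.

Definition is_reduction J I : Prop :=
  [/\ is_ideal I, is_ideal J, ideal_sub J I
    & exists s : nat,
        ideal_eq (ideal_exp I s.+1) (ideal_mul J (ideal_exp I s))].

Definition is_minimal_reduction J I : Prop :=
  is_reduction J I /\
  forall J', is_reduction J' I -> ideal_sub J' J -> ideal_eq J' J.

End Ideals.

Definition lin_indep (K : fieldType) (V : lmodType K) (k : nat)
    (v : 'I_k -> V) : Prop :=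
  forall c : 'I_k -> K, \sum_(i < k) c i *: v i = 0 -> forall i, c i = 0.

Section Arrangement.
Variables (K : fieldType) (n m : nat).
Implicit Types l : 'I_m -> {mpoly K[n]}.

(* Row i lists the coefficients of the linear form l i, so the rank of the
   arrangement (the codimension of the intersection of its hyperplanes) is the
   rank of this matrix. *)
Definition coef_mx l : 'M[K]_(m, n) := \matrix_(i, j) (l i)@_U_(j).

Definition generic_arrangement l : Prop :=
  [/\ forall i, l i != 0 /\ l i \is 1.-homog,
      forall (i j : 'I_m) (c : K), i != j -> l i <> c *: l j,
      \rank (coef_mx l) = n
    & forall f : 'I_n -> 'I_m, injective f -> lin_indep (fun k => l (f k))].

Definition defining_form l : {mpoly K[n]} := \prod_(i < m) l i.

Definition gradient_ideal (F : {mpoly K[n]}) : {mpoly K[n]} -> Prop :=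
  ideal_gen (fun p => exists j : 'I_n, p = F^`M(j)).

(* The quotient F / l_i of the defining form F is written as the product of
   the remaining forms. *)
Definition fold_products_ideal l : {mpoly K[n]} -> Prop :=
  ideal_gen (fun p => exists i : 'I_m, p = \prod_(j < m | j != i) l j).

End Arrangement.

(* Main.v *)
(* Write [F_i = F / l_i] and [D_v] for the derivative in the direction [v], so
   that [D_v F = \sum_i l_i(v) F_i].

   Reduction. We have [I^n = J I^(n-1)]. A product of [n] distinct [F_i] lies in
   [J I^(n-1)] by Euler's formula for [m F], as [m] is invertible. In a product
   with a repeated factor [F_b], choose [v] with [l_b(v) = 1] killing the other
   forms that occur: modulo [D_v F], [F_b] is a combination of factors that do
   not occur yet, so the number of distinct factors can be increased.

   Minimality. Let [L] be a reduction of [I] contained in [J]. By induction on a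
   set [U] of hyperplanes, a power of [\prod_(i notin U) l_i] multiplies [J] into
   [L]; for [U] the set of all hyperplanes this says [J = L]. Each step is a form
   of Nakayama's lemma, at a flat away from the origin if [|U| <= n] and at the
   origin otherwise. At a flat, arcs that separate the [F_b] with [b] in [U] show
   that they are needed in [L] modulo the ideal of the flat. At the origin, if the
   initial forms of [L] did not span those of [J], then those of the powers of
   [I] would grow like the powers of [n - 1] forms, whereas [I] contains [n]
   algebraically independent forms of the same degree. *)

Require Import Defs.
From Stdlib Require Import Classical.
From HB Require Import structures.
From mathcomp Require Import all_boot all_order all_algebra.
From mathcomp Require Import mpoly ring.

Set Implicit Arguments.
Unset Strict Implicit.
Unset Printing Implicit Defensive.

Import GRing.Theory.
Local Open Scope ring_scope.

(** * Ideals: powers, radicals, Nakayama's lemma and colons *)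

Section IdealTheory.
Variable R : comNzRingType.
Implicit Types (I J P Q : R -> Prop) (S : R -> Prop).

Lemma ideal_opp I x : is_ideal I -> I x -> I (- x).
Proof. by case=> _ _ IM Ix; rewrite -mulN1r; exact: IM. Qed.

Lemma ideal_subr I x y : is_ideal I -> I x -> I y -> I (x - y).
Proof. by move=> idI Ix Iy; case: (idI) => _ ID _; apply: ID => //; apply: ideal_opp. Qed.

Lemma ideal_mulr I x a : is_ideal I -> I x -> I (x * a).
Proof. by case=> _ _ IM Ix; rewrite mulrC; apply: IM. Qed.

Lemma ideal_sum I (T : Type) (r : seq T) (p : pred T) (F : T -> R) :
  is_ideal I -> (forall i, p i -> I (F i)) -> I (\sum_(i <- r | p i) F i).
Proof. by case=> I0 ID _ IF; apply: (big_ind I). Qed.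

Lemma ideal_gen_ideal S : is_ideal (ideal_gen S).
Proof.
split.
- exists 0%N, (fun=> 0), (fun=> 0); split; first by case.
  by rewrite big_ord0.
- move=> _ _ [k [a [s [Ss ->]]]] [k' [a' [s' [Ss' ->]]]].
  exists (k + k')%N, (fun i => match split i with inl j => a j | inr j => a' j end),
    (fun i => match split i with inl j => s j | inr j => s' j end).
  split=> [i|]; first by case: split.
  rewrite big_split_ord; congr (_ + _); apply: eq_bigr => i _.
    by rewrite -[lshift _ _]/(unsplit (inl _ i)) unsplitK.
  by rewrite -[rshift _ _]/(unsplit (inr _ i)) unsplitK.
- move=> b _ [k [a [s [Ss ->]]]]; exists k, (fun i => b * a i), s.
  by split=> //; rewrite mulr_sumr; apply: eq_bigr => i _; rewrite mulrA.
Qed.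

Lemma ideal_gen_incl S x : S x -> ideal_gen S x.
Proof.
move=> Sx; exists 1%N, (fun=> 1), (fun=> x); split=> //.
by rewrite big_ord1 mul1r.
Qed.

Lemma ideal_gen_min S P :
  is_ideal P -> (forall x, S x -> P x) -> ideal_sub (ideal_gen S) P.
Proof.
move=> idP SP _ [k [a [s [Ss ->]]]]; apply: ideal_sum => // i _.
by case: idP => _ _; apply; apply: SP.
Qed.

Lemma ideal_gen_familyP q (f : 'I_q -> R) x :
  ideal_gen (fun p => exists i, p = f i) x <->
  exists w : 'I_q -> R, x = \sum_i w i * f i.
Proof.
split=> [|[w ->]]; last first.
  apply: ideal_sum => [|i _]; first exact: ideal_gen_ideal.
  have [_ _] := ideal_gen_ideal (fun p => exists i, p = f i); apply.
  by apply: ideal_gen_incl; exists i.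
apply: (ideal_gen_min (P := fun x => exists w, x = \sum_i w i * f i)); first split.
- by exists (fun=> 0); rewrite big1 // => i _; rewrite mul0r.
- move=> _ _ [w ->] [w' ->]; exists (fun i => w i + w' i).
  by rewrite -big_split; apply: eq_bigr => i _; rewrite mulrDl.
- move=> a _ [w ->]; exists (fun i => a * w i).
  by rewrite mulr_sumr; apply: eq_bigr => i _; rewrite mulrA.
- move=> _ [i ->]; exists (fun j => (j == i)%:R).
  rewrite (bigD1 i) //= eqxx mul1r big1 ?addr0 // => j /negPf->.
  by rewrite mul0r.
Qed.

Lemma ideal_mul_ideal I J : is_ideal (ideal_mul I J).
Proof. exact: ideal_gen_ideal. Qed.

Lemma ideal_mul_in I J a b : I a -> J b -> ideal_mul I J (a * b).
Proof. by move=> Ia Jb; apply: ideal_gen_incl; exists a, b. Qed.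

Lemma ideal_mulS I I' J J' : ideal_sub I I' -> ideal_sub J J' ->
  ideal_sub (ideal_mul I J) (ideal_mul I' J').
Proof.
move=> sI sJ; apply: ideal_gen_min => [|_ [a [b [/sI Ia /sJ Jb ->]]]].
  exact: ideal_mul_ideal.
exact: ideal_mul_in.
Qed.

Lemma ideal_mul_subl I J : is_ideal I -> ideal_sub (ideal_mul I J) I.
Proof.
by move=> idI; apply: ideal_gen_min => // _ [a [b [Ia _ ->]]]; apply: ideal_mulr.
Qed.

Lemma ideal_exp_prod I (u : seq R) :
  (forall x, x \in u -> I x) -> ideal_exp I (size u) (\prod_(x <- u) x).
Proof.
elim: u => [//|x u IHu] Iu; rewrite big_cons /=; apply: ideal_mul_in.
  by apply: Iu; rewrite mem_head.
by apply: IHu => y yu; apply: Iu; rewrite inE yu orbT.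
Qed.

Lemma ideal_exp_expr I x s : I x -> ideal_exp I s (x ^+ s).
Proof. by move=> Ix; elim: s => //= s IHs; rewrite exprS; apply: ideal_mul_in. Qed.

(** Multiplying by further factors of [I] preserves the inclusion. The dimension count at the origin
    needs it for arbitrarily high powers of [I]. *)
Lemma ideal_exp_reduction J I s N :
  ideal_sub (ideal_exp I s.+1) (ideal_mul J (ideal_exp I s)) ->
  ideal_sub (ideal_exp I (s + N).+1) (ideal_mul J (ideal_exp I (s + N))).
Proof.
move=> red; elim: N => [|N IHN]; first by rewrite addn0.
rewrite addnS => x; apply: ideal_gen_min x => [|_ [a [b [Ia /IHN Jb ->]]]].
  exact: ideal_mul_ideal.
have [M0 MD MM] := ideal_mul_ideal J (ideal_exp I (s + N).+1).
apply: (ideal_gen_min (P := fun b => ideal_mul J _ (a * b))) Jb.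
  split=> [|y z|c y]; first by rewrite mulr0.
    by rewrite mulrDr; apply: MD.
  by rewrite mulrCA; apply: MM.
move=> _ [j [z [Jj Iz ->]]]; rewrite mulrCA.
by apply: ideal_mul_in => //; apply: ideal_mul_in.
Qed.

Definition ideal_rad Q x := exists N, Q (x ^+ N).

Lemma ideal_exprW Q x N N' : is_ideal Q -> (N <= N')%N -> Q (x ^+ N) -> Q (x ^+ N').
Proof. by case=> _ _ QM le; rewrite -(subnK le) exprD; apply: QM. Qed.

Lemma ideal_rad_ideal Q : is_ideal Q -> is_ideal (ideal_rad Q).
Proof.
move=> idQ; have [Q0 QD QM] := idQ; split.
- by exists 1%N; rewrite expr1.
- move=> x y [N QN] [N' QN']; exists (N + N')%N; rewrite exprDn.
  apply: ideal_sum => // i _; rewrite -mulr_natl; apply: (QM).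
  have [le|lt] := leqP N' i; first exact: (QM _ _ (ideal_exprW idQ le QN')).
  apply: ideal_mulr => //; apply: ideal_exprW QN => //.
  by rewrite -addnBA ?leq_addr // ltnW.
- by move=> a x [N QN]; exists N; rewrite exprMn; apply: QM.
Qed.

Lemma ideal_rad_incl Q x : Q x -> ideal_rad Q x.
Proof. by exists 1%N; rewrite expr1. Qed.

Lemma ideal_rad_expr Q x k : ideal_rad Q (x ^+ k) -> ideal_rad Q x.
Proof. by case=> N QN; exists (k * N)%N; rewrite exprM. Qed.

Lemma ideal_bigmul I (T : eqType) (r : seq T) (p q : T -> R) :
  is_ideal I -> (forall i, I (p i - q i)) ->
  I (\prod_(i <- r) p i - \prod_(i <- r) q i).
Proof.
move=> idI Ipq; have [I0 ID IM] := idI.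
apply: (big_ind2 (fun x y => I (x - y))) => // [|x y z t Ixy Izt].
  by rewrite subrr.
have -> : x * z - y * t = z * (x - y) + y * (z - t) by ring.
by apply: ID; apply: IM.
Qed.

Lemma ideal_subX I x y k : is_ideal I -> I (x - y) -> I (x ^+ k - y ^+ k).
Proof. by move=> idI Ixy; rewrite subrXX mulrC; have [_ _] := idI; apply. Qed.

Lemma ideal_det I q (A B : 'M[R]_q) :
  is_ideal I -> (forall i j, I (A i j - B i j)) -> I (\det A - \det B).
Proof.
move=> idI IAB; rewrite /determinant -sumrB; apply: ideal_sum => // s _.
by rewrite -mulrBr; case: (idI) => _ _; apply; apply: ideal_bigmul.
Qed.

(* The determinant trick behind Nakayama's lemma. *)
Lemma nakayama J P q (f : 'I_q -> R) (a : R) (A : 'M[R]_q) :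
  is_ideal J -> is_ideal P ->
  (forall i, J (\sum_k A i k * f k)) ->
  (forall i k, P (A i k - a *+ (i == k))) ->
  exists2 mu, P mu & forall k, J ((a ^+ q + mu) * f k).
Proof.
(* Modulo [P] the matrix is the scalar matrix [a], so its determinant is [a ^+ q] up to an element
   of [P]; the adjugate shows that this determinant multiplies every [f k] into [J]. *)
move=> idJ idP JA PA; exists (\det A - a ^+ q).
  by rewrite -det_scalar; apply: ideal_det => // i j; rewrite !mxE.
move=> k; rewrite addrCA subrr addr0.
have -> : \det A * f k = \sum_i (\adj A) k i * (\sum_j A i j * f j).
  have := congr1 (fun M : 'M_q => (M *m \col_j f j) k 0) (mul_adj_mx A).
  rewrite -mulmxA mul_scalar_mx mxE [RHS]mxE [X in _ = _ * X]mxE => <-.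
  apply: eq_bigr => i _; rewrite [X in _ * X]mxE; congr (_ * _).
  by apply: eq_bigr => j _; rewrite mxE.
by apply: ideal_sum => // i _; case: (idJ) => _ _; apply; apply: JA.
Qed.

Definition colon J (f : R -> Prop) : R -> Prop := fun r => forall x, f x -> J (r * x).

Lemma colon_ideal J f : is_ideal J -> is_ideal (colon J f).
Proof.
case=> J0 JD JM; split=> [x _|a b Ja Jb x fx|a b Jb x fx].
- by rewrite mul0r.
- by rewrite mulrDl; apply: JD; [apply: Ja | apply: Jb].
- by rewrite -mulrA; apply/JM/Jb.
Qed.

End IdealTheory.

Section FamilyPowers.
Variables (R : comNzRingType) (q : nat) (f : 'I_q -> R).

Lemma ideal_exp_family_min (P : R -> Prop) s : is_ideal P ->
  (forall u : seq 'I_q, size u = s -> P (\prod_(i <- u) f i)) ->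
  ideal_sub (ideal_exp (ideal_gen (fun p => exists i, p = f i)) s) P.
Proof.
elim: s P => [|s IHs] P idP Pf /=.
  move=> x _; have [_ _] := idP => /(_ x _ (Pf [::] erefl)).
  by rewrite big_nil mulr1.
have [P0 PD PM] := idP.
apply: ideal_gen_min => // _ [x [b [Ix Ib ->]]].
apply: (ideal_gen_min (P := fun x => P (x * b))) Ix.
  split=> [|y z|c y]; first by rewrite mul0r.
    by rewrite mulrDl; apply: PD.
  by rewrite -mulrA; apply: PM.
move=> _ [i ->]; apply: (IHs (fun b => P (f i * b))) Ib.
  split=> [|y z|c y]; first by rewrite mulr0.
    by rewrite mulrDr; apply: PD.
  by rewrite mulrCA; apply: PM.
by move=> u su; have := Pf (i :: u); rewrite big_cons /= su; apply.
Qed.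

Lemma ideal_exp_prod_card (T : finType) (A : {pred T}) (I : R -> Prop) (g : T -> R) :
  (forall i, I (g i)) -> ideal_exp I #|A| (\prod_(i in A) g i).
Proof.
move=> Ig; rewrite -big_enum -(big_map g predT id) cardE -(size_map g).
by apply: ideal_exp_prod => _ /mapP[i _ ->].
Qed.

End FamilyPowers.

Lemma prod_seq_count (A : comNzRingType) q (x : 'I_q -> A) (t : seq 'I_q) :
  \prod_(i <- t) x i = \prod_k x k ^+ count_mem k t.
Proof.
elim: t => [|i t IHt]; first by rewrite big_nil big1.
have xE k : x k ^+ count_mem k (i :: t) = x k ^+ (i == k) * x k ^+ count_mem k t.
  by rewrite -exprD.
rewrite (eq_bigr _ (fun k _ => xE k)) big_cons IHt big_split; congr (_ * _).
rewrite (bigD1 i) //= eqxx expr1 big1 ?mulr1 // => k ki.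
by rewrite eq_sym (negPf ki).
Qed.

(** * Linear algebra and counting *)

Section FiniteSpans.
Variables (K : fieldType) (V : lmodType K) (T : finType) (A : {set T}) (e : T -> V).

Definition fin_span x := exists c : T -> K, x = \sum_(t in A) c t *: e t.

Lemma fin_span0 : fin_span 0.
Proof. by exists (fun=> 0); rewrite big1 // => t _; rewrite scale0r. Qed.

Lemma fin_spanD x y : fin_span x -> fin_span y -> fin_span (x + y).
Proof.
move=> [c ->] [d ->]; exists (fun t => c t + d t); rewrite -big_split.
by apply: eq_bigr => t _; rewrite scalerDl.
Qed.

Lemma fin_spanZ b x : fin_span x -> fin_span (b *: x).
Proof.
move=> [c ->]; exists (fun t => b * c t); rewrite scaler_sumr.
by apply: eq_bigr => t _; rewrite scalerA.
Qed.

Lemma fin_span_sum (I : Type) (r : seq I) (P : pred I) (F : I -> V) :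
  (forall i, P i -> fin_span (F i)) -> fin_span (\sum_(i <- r | P i) F i).
Proof.
by move=> PF; apply: (big_ind fin_span) => //; [exact: fin_span0 | exact: fin_spanD].
Qed.

Lemma fin_span_in t : t \in A -> fin_span (e t).
Proof.
move=> At; exists (fun t' => (t' == t)%:R); rewrite (bigD1 t) //= eqxx scale1r.
by rewrite big1 ?addr0 // => t' /andP[_ /negPf->]; rewrite scale0r.
Qed.

(** Steinitz's bound: with more free vectors than spanning ones, the coefficient matrix would have
    more rows than columns, and a nonzero row vector killing it would be a relation among the free
    vectors. *)
Lemma card_free_le_span (T1 : finType) (B : {set T1}) (u : T1 -> V) :
  (forall c : T1 -> K, \sum_(t in B) c t *: u t = 0 -> forall t, t \in B -> c t = 0) ->
  (forall t, t \in B -> fin_span (u t)) -> (#|B| <= #|A|)%N.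
Proof.
move=> freeu spu; rewrite leqNgt; apply/negP => ltAB.
have [C CE] : exists C : T1 -> T -> K, forall t, t \in B ->
    u t = \sum_(t' in A) C t t' *: e t'.
  apply: (fin_all_exists (U := fun=> T -> K)
    (P := fun t c => t \in B -> u t = \sum_(t' in A) c t' *: e t')) => t.
  by have [/spu[c uE]|_] := boolP (t \in B); [exists c | exists (fun=> 0)].
pose M := \matrix_(i < #|B|, j < #|A|) C (enum_val i) (enum_val j).
have : kermx M != 0.
  rewrite kermx_eq0 -row_leq_rank -ltnNge.
  exact: leq_ltn_trans (rank_leq_col M) ltAB.
case/rowV0Pn=> v /sub_kermxP vM /eqP[]; apply/rowP => i; rewrite mxE.
pose c t := \sum_(i | enum_val i == t) v 0 i.
have cE j : c (enum_val j) = v 0 j.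
  by rewrite /c (big_pred1 j) // => i'; rewrite (inj_eq enum_val_inj).
rewrite -cE; apply: freeu (enum_valP i).
rewrite big_enum_val; under eq_bigr => j _ do rewrite cE CE ?enum_valP // scaler_sumr.
rewrite exchange_big big_enum_val big1 // => j _ /=.
under eq_bigr do rewrite scalerA; rewrite -scaler_suml.
have := congr1 (fun M : 'rV_ _ => M 0 j) vM; rewrite !mxE.
by under eq_bigr do rewrite mxE; move=> ->; rewrite scale0r.
Qed.

End FiniteSpans.

(** Membership in [W] is undecidable, so no basis can be computed. Instead a matrix [A] with rows in
    [W] is enlarged by a vector of [W] outside its row space, raising the rank, until its row space
    contains [W]. *)
Lemma subspace_or_hyperplane (K : fieldType) n (W : 'rV[K]_n -> Prop) :
  (forall (p : nat) (u : 'rV_p) (A : 'M_(p, n)), (forall i, W (row i A)) -> W (u *m A)) ->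
  (forall v, W v) \/ exists B : 'M_(n.-1, n), forall v, W v -> (v <= B)%MS.
Proof.
move=> Wlin; suff H (A : 'M[K]_n) : (forall i, W (row i A)) ->
    (forall v, W v) \/ exists B : 'M_(n.-1, n), forall v, W v -> (v <= B)%MS.
  apply: (H 0) => i; rewrite row0 -(mulmx0 _ (0 : 'rV_0)); apply: Wlin.
  by case.
have [d] := ubnP (n - \rank A); elim: d A => // d IHd A ltd WA.
have [WsubA|nWsubA] := classic (forall v, W v -> (v <= A)%MS).
  have [fullA|] := boolP (row_full A).
    left=> v; have /submxP[u ->] := submx_full v fullA; exact: Wlin.
  rewrite /row_full => neqn.
  have ltr : (\rank A < n)%N by rewrite ltn_neqAle neqn rank_leq_col.
  have ltrn : (\rank A <= n.-1)%N by rewrite -ltnS prednK // (leq_ltn_trans _ ltr).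
  right; exists (pid_mx (\rank A) *m row_ebase A) => v /WsubA vA.
  (* A row space of rank at most [n.-1] is spanned by [n.-1] rows, here taken from the extended
     basis [row_ebase A]. *)
  apply: submx_trans vA _; rewrite -{1}[A]mulmx_ebase -mulmxA.
  apply: submx_trans (submxMl _ _) _.
  rewrite -(@pid_mx_id K n n.-1 n _ ltrn) -mulmxA; exact: submxMl.
have [v nv] := not_all_ex_not _ _ nWsubA.
have [Wv /negP vA] := imply_to_and _ _ nv.
apply: (IHd (A + v)%MS).
  have ltrank : (\rank A < \rank (A + v)%MS)%N.
    by apply: rank_ltmx; rewrite /ltmx addsmxSl addsmx_sub submx_refl.
  rewrite -ltnS; apply: leq_trans ltd; rewrite ltnS ltn_sub2l //.
  exact: leq_trans ltrank (rank_leq_col _).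
move=> i; have /sub_addsmxP[[u1 u2] ->] := row_sub i (A + v)%MS.
rewrite -mul_row_col; apply: Wlin => j.
rewrite -[j]splitK; case: split => k /=; first by rewrite rowKu.
by rewrite rowKd row_id.
Qed.

(** The sorted tuples in [basis n d] encode the monomials of degree [d] in [n] variables. *)
Lemma card_basis n d : (0 < n)%N -> #|basis n d| = 'C(d + n.-1, d).
Proof. by case: n => // n _; apply: card_sorted_tuples. Qed.

Lemma binomial_growth q D s :
  exists N, ('C(N + q, N) * D < 'C(N + s + q.+1, N + s))%N.
Proof.
(* The ratio of ['C(N + q.+1, q.+1)] to ['C(N + q, q)] is [(N + q.+1) / q.+1], which exceeds [D] for
   this [N]. *)
pose N := (D * q.+1)%N; exists N.
have symC a b : 'C(a + b, a) = 'C(a + b, b) by rewrite -bin_sub ?leq_addr // addKn.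
rewrite !symC.
apply: (@leq_trans 'C(N + q.+1, q.+1)); last first.
  by apply: leq_bin2l; rewrite leq_add2r leq_addr.
rewrite -(ltn_pmul2l (ltn0Sn q)) addnS -mul_bin_diag /= mulnCA mulnC ltn_pmul2r.
  by rewrite ltnS mulnC -/N leq_addr.
by rewrite bin_gt0 leq_addl.
Qed.

(** * Linear forms and the product rule *)

Lemma linear_formE (K : fieldType) n (p : {mpoly K[n]}) :
  p \is 1.-homog -> p = \sum_j p@_U_(j) *: 'X_j.
Proof.
move=> hp; apply/mpolyP => mo; rewrite raddf_sum /=.
under eq_bigr do rewrite mcoeffZ mcoeffX.
have [/mdeg1P[i /eqP->]|mo1] := boolP (mdeg mo == 1%N).
  rewrite (bigD1 i) //= eqxx mulr1 big1 ?addr0 // => j /negPf ji.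
  by rewrite -mcoeffX mcoeffXU ji mulr0.
rewrite (dhomog_nemf_coeff hp mo1) big1 // => j _.
by case: (_ =P mo) mo1 => [<-|_]; rewrite ?mdeg1 ?eqxx ?mulr0.
Qed.

Lemma mderiv_prod (R : comNzRingType) n (T : eqType) (l : T -> {mpoly R[n]})
    (r : seq T) j : uniq r ->
  (\prod_(i <- r) l i)^`M(j) =
    \sum_(i <- r) (l i)^`M(j) * \prod_(k <- r | k != i) l k.
Proof.
elim: r => [|i r IHr] /=; first by rewrite !big_nil -mpolyC1 mderivC.
case/andP=> ir ur; rewrite !big_cons mderivM eqxx /= (IHr ur) mulr_sumr.
congr (_ * _ + _).
  rewrite [RHS]big_seq_cond [LHS]big_seq; apply: eq_bigl => k.
  by case kr: (k \in r) => //=; symmetry; apply: contraNneq ir => <-.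
rewrite !big_seq; apply: eq_bigr => k kr; rewrite big_cons.
by case: eqP ir => [->|_ _]; [rewrite kr | rewrite mulrCA].
Qed.

(** * Arcs, and what a reduction implies along them *)

(* Initial forms along an arc [phi : R -> R[t]]: on [ideal_exp I t] the map
   [theta^t phi] is divisible by [omega^t], and [a] is the value at [t = 0] of
   the quotient. *)
Section InitialForms.
Variables (R : idomainType) (phi : {rmorphism R -> {poly R}}).
Variables (theta omega : {poly R}).
Hypothesis omega_neq0 : omega != 0.

Definition initial k x a :=
  exists2 la, theta ^+ k * phi x = omega ^+ k * la & la.[0] = a.

Lemma initial0 k : initial k 0 0.
Proof. by exists 0; rewrite ?horner0 // rmorph0 !mulr0. Qed.

Lemma initialD k x y a b :
  initial k x a -> initial k y b -> initial k (x + y) (a + b).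
Proof.
case=> la xE <- [lb yE <-]; exists (la + lb); last by rewrite hornerD.
by rewrite rmorphD !mulrDr xE yE.
Qed.

Lemma initialM k k' x y a b :
  initial k x a -> initial k' y b -> initial (k + k') (x * y) (a * b).
Proof.
case=> la xE <- [lb yE <-]; exists (la * lb); last by rewrite hornerM.
by rewrite rmorphM !exprD mulrACA xE yE mulrACA.
Qed.

Lemma initialC x : initial 0 x (phi x).[0].
Proof. by exists (phi x); rewrite ?expr0. Qed.

Lemma initialZ k r x a : initial k x a -> initial k (r * x) ((phi r).[0] * a).
Proof. by move=> xa; rewrite -[k]add0n; apply: initialM => //; apply: initialC. Qed.

Lemma initialX k x a : initial 1 x a -> initial k (x ^+ k) (a ^+ k).
Proof.
move=> xa; elim: k => [|k IHk].
  by exists 1; rewrite ?hornerC // !expr0 rmorph1.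
by rewrite !exprS -add1n; apply: initialM.
Qed.

Lemma initial_sum k (T : Type) (r : seq T) (x a : T -> R) :
  (forall i, initial k (x i) (a i)) ->
  initial k (\sum_(i <- r) x i) (\sum_(i <- r) a i).
Proof.
move=> xa; apply: (big_ind2 (initial k)) => //; first exact: initial0.
by move=> *; apply: initialD.
Qed.

Lemma initial_inj k x a b : initial k x a -> initial k x b -> a = b.
Proof.
by case=> la xE <- [lb]; rewrite xE => /(mulfI (expf_neq0 _ omega_neq0))-> <-.
Qed.

Variables (I : R -> Prop).
Hypothesis initial_I : forall x, I x -> exists a, initial 1 x a.

Lemma initial_exp s x : ideal_exp I s x -> exists a, initial s x a.
Proof.
elim: s x => [|s IHs] x /=; first by exists (phi x).[0]; apply: initialC.
apply: (ideal_gen_min (P := fun x => exists a, initial s.+1 x a)).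
  split=> [|y z [b yb] [c zc]|r y [b yb]]; first by exists 0; apply: initial0.
    by exists (b + c); apply: initialD.
  by exists ((phi r).[0] * b); apply: initialZ.
move=> _ [y [z [/initial_I[b yb] /IHs[c zc] ->]]].
by exists (b * c); apply: (initialM yb zc).
Qed.

(** The valuative criterion for integrality, in arc form. Since [x ^+ s.+1] is a combination of
    products from [J] and [ideal_exp I s], each of which has its initial value in [P], uniqueness of
    initial values puts [a ^+ s.+1] in [P]. *)
Lemma initial_reduction (J P : R -> Prop) s x a : is_ideal P ->
  (forall y, J y -> exists2 b, P b & initial 1 y b) ->
  ideal_sub (ideal_exp I s.+1) (ideal_mul J (ideal_exp I s)) ->
  I x -> initial 1 x a -> P (a ^+ s.+1).
Proof.
move=> [P0 PD PM] initial_J red Ix xa.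
have : ideal_mul J (ideal_exp I s) (x ^+ s.+1) by apply/red/ideal_exp_expr.
pose Q x := exists2 b, P b & initial s.+1 x b.
case/(ideal_gen_min (P := Q)) => [||b Pb /(initial_inj (initialX s.+1 xa))->//].
  split=> [|y z [b Pb yb] [c Pc zc]|r y [b Pb yb]].
  - by exists 0 => //; apply: initial0.
  - by exists (b + c); [apply: PD | apply: initialD].
  - by exists ((phi r).[0] * b); [apply: PM | apply: initialZ].
move=> _ [y [z [/initial_J[b Pb yb] /initial_exp[c zc] ->]]].
exists (b * c); last exact: (initialM yb zc).
by rewrite mulrC; apply: PM.
Qed.

End InitialForms.

Section Arcs.
Variables (K : fieldType) (n : nat).
Local Notation R := {mpoly K[n]}.

Definition const_arc : {rmorphism K -> {poly R}} := (@polyC R \o @mpolyC n K).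

(** The coefficients of the [h j] are themselves polynomials, so an arc may start at the generic
    point of a flat and not only at a point over [K]. *)
Definition arc (h : 'I_n -> {poly R}) : {rmorphism R -> {poly R}} :=
  mmap const_arc h.

Lemma arc_form h (p : R) : p \is 1.-homog ->
  arc h p = \sum_j const_arc p@_U_(j) * h j.
Proof.
move=> /linear_formE pE; rewrite {1}pE rmorph_sum; apply: eq_bigr => j _.
by rewrite /= mmapZ mmapX mmap1U.
Qed.

(** Evaluating the arc at [t = 0] is a [K]-algebra map, so a congruence with the identity need only
    be checked on the variables. *)
Lemma arc_congr (P : R -> Prop) h : is_ideal P ->
  (forall j, P ('X_j - (h j).[0])) -> forall r, P (r - (arc h r).[0]).
Proof.
move=> idP Ph r; have [P0 PD PM] := idP.
rewrite {1 2}[r]mpolyE rmorph_sum horner_sum -sumrB.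
apply: ideal_sum => // mo _; rewrite /= mmapZ hornerM !hornerC -mul_mpolyC -mulrBr.
apply: (PM); rewrite mmapX mpolyXE_id /mmap1 horner_prod.
apply: ideal_bigmul => // j; rewrite horner_exp.
exact: ideal_subX.
Qed.

Lemma arc_origin h : (forall j, (h j).[0] = 0) ->
  forall r, (arc h r).[0] = (r.@[fun=> 0])%:MP.
Proof.
move=> h0 r; rewrite mevalE /= /mmap horner_sum rmorph_sum; apply: eq_bigr => mo _ /=.
rewrite hornerM hornerC rmorphM; congr (_ * _).
rewrite /mmap1 horner_prod rmorph_prod; apply: eq_bigr => j _.
by rewrite horner_exp h0 rmorphXn rmorph0.
Qed.

End Arcs.

(** * Generic arrangements: dual bases and the gradient *)

Section GenericArrangement.
Variables (K : fieldType) (n m : nat) (l : 'I_m -> {mpoly K[n]}).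
Hypotheses (n_lt_m : (n + 1 <= m)%N) (l_gen : generic_arrangement l).

Let a i j := (l i)@_U_(j).
Let F := defining_form l.
Let Fi (i : 'I_m) : {mpoly K[n]} := \prod_(j < m | j != i) l j.
Let I := fold_products_ideal l.
Let J := gradient_ideal F.

Lemma le_n_m : (n <= m)%N.
Proof. by apply: leq_trans n_lt_m; rewrite leq_addr. Qed.

Lemma formE i : l i = \sum_j a i j *: 'X_j.
Proof. by apply: linear_formE; case: l_gen => /(_ i)[]. Qed.

Lemma form_neq0 i : l i != 0.
Proof. by case: l_gen => /(_ i)[]. Qed.

(** Genericity concerns exactly [n] forms at a time; this completes a smaller set. Listing [U]
    before its complement, the first [n] entries contain [U]. *)
Lemma injective_extension (U : {set 'I_m}) : (#|U| <= n)%N ->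
  exists f : 'I_n -> 'I_m, injective f /\ forall i, i \in U -> exists k, f k = i.
Proof.
move=> leUn; pose u := enum U ++ enum (~: U).
have uu : uniq u.
  rewrite cat_uniq !enum_uniq andbT; apply/hasPn => i.
  by rewrite !mem_enum inE.
have su : size u = m by rewrite size_cat -!cardE cardsC card_ord.
have m0 : (0 < m)%N by apply: leq_trans n_lt_m; rewrite addn1.
pose i0 := Ordinal m0; exists (fun k => nth i0 u k); split=> [k k' /eqP|i Ui].
  by rewrite nth_uniq ?su //; [move/eqP/val_inj | apply: leq_trans le_n_m..].
have lti : (index i u < n)%N.
  apply: leq_trans leUn; rewrite cardE index_cat mem_enum Ui.
  by rewrite index_mem mem_enum.
by exists (Ordinal lti); rewrite nth_index // mem_cat mem_enum Ui.
Qed.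

(** [V] is the inverse of the coefficient matrix of the chosen forms: its columns are the dual
    points, its rows express the variables in these forms. *)
Lemma dual_basis (f : 'I_n -> 'I_m) : injective f ->
  exists V : 'M[K]_n,
    (forall k k', \sum_j a (f k) j * V j k' = (k == k')%:R) /\
    (forall j, 'X_j = \sum_k V j k *: l (f k)).
Proof.
move=> injf; pose A := \matrix_(k, j) a (f k) j.
have Au : A \in unitmx.
  rewrite -row_free_unit -kermx_eq0; apply/rowV0P => v /sub_kermxP vA.
  have [_ _ _ /(_ f injf)] := l_gen => /(_ (v 0)) H.
  apply/rowP => k; rewrite mxE H //.
  under eq_bigr do rewrite formE scaler_sumr.
  rewrite exchange_big big1 //= => j _.
  under eq_bigr do rewrite scalerA; rewrite -scaler_suml.
  have := congr1 (fun M : 'rV_n => M 0 j) vA; rewrite !mxE.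
  by under eq_bigr do rewrite mxE; move=> ->; rewrite scale0r.
exists (invmx A); split=> [k k'|j].
  have := congr1 (fun M : 'M_n => M k k') (mulmxV Au); rewrite !mxE => <-.
  by apply: eq_bigr => j _; rewrite mxE.
under eq_bigr do rewrite formE scaler_sumr.
rewrite exchange_big /= (bigD1 j) //= -[LHS]addr0; congr (_ + _).
  under eq_bigr do rewrite scalerA; rewrite -scaler_suml.
  have := congr1 (fun M : 'M_n => M j j) (mulVmx Au); rewrite !mxE eqxx.
  by under eq_bigr do rewrite mxE; move=> ->; rewrite scale1r.
rewrite big1 // => j' jj'.
under eq_bigr do rewrite scalerA; rewrite -scaler_suml.
have := congr1 (fun M : 'M_n => M j j') (mulVmx Au); rewrite !mxE.
under eq_bigr do rewrite mxE.
by move=> ->; rewrite eq_sym (negPf jj') scale0r.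
Qed.

Lemma dual_vectors (U : {set 'I_m}) : (#|U| <= n)%N ->
  exists c : 'I_m -> 'I_n -> K,
    forall i b, i \in U -> b \in U -> \sum_j a i j * c b j = (i == b)%:R.
Proof.
move=> /injective_extension[f [injf fU]]; have [V [aV _]] := dual_basis injf.
(* As [f] is injective, the sum has at most one term: it is the column of [V] at the preimage of
   [b], or 0 if there is none. *)
exists (fun b j => \sum_(k | f k == b) V j k) => _ _ /fU[k <-] /fU[k' <-].
rewrite (inj_eq injf) -aV; apply: eq_bigr => j _.
by rewrite (big_pred1 k') // => i; rewrite (inj_eq injf).
Qed.

Lemma span_forms (U : {set 'I_m}) (j : 'I_n) : (n <= #|U|)%N ->
  exists c : 'I_m -> K, 'X_j = \sum_(i in U) c i *: l i.
Proof.
move=> leU; have [V sVU cV] : exists2 V : {set 'I_m}, V \subset U & #|V| = n.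
  exists [set i in take n (enum U)].
    by apply/subsetP => i; rewrite inE => /mem_take; rewrite mem_enum.
  by rewrite cardsE (card_uniqP _) ?take_uniq ?enum_uniq // size_takel // -cardE.
have /injective_extension[f [injf fV]] : (#|V| <= n)%N by rewrite cV.
have VE : V = [set f k | k in 'I_n].
  apply/eqP; rewrite eqEcard card_imset // card_ord cV leqnn andbT.
  by apply/subsetP => i /fV[k <-]; apply: imset_f.
have [B [_ /(_ j)->]] := dual_basis injf.
exists (fun i => if i \in V then \sum_(k | f k == i) B j k else 0).
rewrite (bigID (mem V)) /= [X in _ + X]big1 ?addr0; last first.
  by move=> i /andP[_ /negPf->]; rewrite scale0r.
under [RHS]eq_bigl => i do
  rewrite andbC (andb_idr (subsetP sVU i)).
rewrite {1}VE big_imset /=; last by move=> ? ? _ _; apply: injf.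
apply: eq_bigr => k _; rewrite VE imset_f //.
by rewrite (big_pred1 k) // => i; rewrite (inj_eq injf).
Qed.

(** A nonzero linear form needs a variable, and in one variable the forms, at least two in number,
    would be proportional. *)
Lemma n_gt1 : (1 < n)%N.
Proof.
have m0 : (0 < m)%N by apply: leq_trans n_lt_m; rewrite addn1.
case n1 : (1 < n)%N => //; exfalso.
have n_gt0 : (0 < n)%N.
  rewrite lt0n; apply/eqP => n0; have /eqP[] := form_neq0 (Ordinal m0).
  by rewrite formE big1 // => j; have := leq_trans (ltn_ord j) (eq_leq n0).
have m1 : (1 < m)%N by apply: leq_trans n_lt_m; rewrite addn1.
pose j0 := Ordinal n_gt0.
have lE i : l i = a i j0 *: 'X_j0.
  rewrite formE (big_pred1 j0) // => j; symmetry; apply/eqP/val_inj => /=.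
  by case: (nat_of_ord j) (ltn_ord j) n1 => // k /leq_trans le; case: ltnP => // /le.
have [_ /(_ (Ordinal m0) (Ordinal m1) (a (Ordinal m0) j0 / a (Ordinal m1) j0))] := l_gen.
move=> /(_ isT) + _ _; apply; rewrite !lE scalerA mulfVK //.
by apply: contraNneq (form_neq0 (Ordinal m1)); rewrite lE => ->; rewrite scale0r.
Qed.

Let idI : is_ideal I. Proof. exact: ideal_gen_ideal. Qed.
Let idJ : is_ideal J. Proof. exact: ideal_gen_ideal. Qed.

Lemma fold_in i : I (Fi i).
Proof. by apply: ideal_gen_incl; exists i. Qed.

Lemma defining_formE i : F = l i * Fi i.
Proof. by rewrite /F /defining_form (bigD1 i). Qed.

Lemma defining_form_neq0 : F != 0.
Proof. by apply/prodf_neq0 => i _; apply: form_neq0. Qed.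

Lemma gradientE j : F^`M(j) = \sum_i a i j *: Fi i.
Proof.
rewrite /F /defining_form mderiv_prod ?index_enum_uniq //.
apply: eq_bigr => i _; rewrite -mul_mpolyC; congr (_ * _).
rewrite {1}formE raddf_sum (bigD1 j) //= mderivZ mderivX mnm1E eqxx.
rewrite -{1}[U_(j)%MM]addm0 addmC addmK mpolyX0 scale1r -mul_mpolyC mulr1.
rewrite big1 ?addr0 // => k kj.
by rewrite mderivZ mderivX mnm1E (negPf kj) scale0r scaler0.
Qed.

(* This is the derivative of [F] in the direction [v]. *)
Lemma directional_in v : J (\sum_i (\sum_j a i j * v j) *: Fi i).
Proof.
have -> : \sum_i (\sum_j a i j * v j) *: Fi i = \sum_j (v j)%:MP * F^`M(j).
  under [RHS]eq_bigr do rewrite gradientE mulr_sumr.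
  rewrite exchange_big; apply: eq_bigr => i _ /=; rewrite scaler_suml.
  by apply: eq_bigr => j _; rewrite mul_mpolyC scalerA mulrC.
apply: ideal_sum => // j _; have [_ _] := idJ; apply.
by apply: ideal_gen_incl; exists j.
Qed.

Lemma gradient_sub : ideal_sub J I.
Proof.
apply: ideal_gen_min => // _ [j ->]; rewrite gradientE.
apply: ideal_sum => // i _; rewrite -mul_mpolyC; have [_ _] := idI; apply.
exact: fold_in.
Qed.

(** * The gradient ideal is a reduction *)

Let JI := ideal_mul J (ideal_exp I n.-1).
Let idJI : is_ideal JI. Proof. exact: ideal_mul_ideal. Qed.

Hypothesis char_ndvd_m : forall p : nat, p \in [pchar K] -> ~~ (p %| m)%N.

Lemma natr_size_neq0 : (m%:R : K) != 0.
Proof.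
have m0 : (0 < m)%N by apply: leq_trans n_lt_m; rewrite addn1.
apply/negP => m_eq0; have /natf0_pchar[//|p pK] := m_eq0.
by have := char_ndvd_m pK; rewrite (dvdn_pcharf pK) m_eq0.
Qed.

(* Euler's formula [m F = \sum_k l_k (D_k F)], multiplied by [\prod_k F / l_k]
   and divided by [F]. *)
Lemma distinct_product f : injective f -> JI (\prod_(k < n) Fi (f k)).
Proof.
move=> injf; have [V [_ VE]] := dual_basis injf.
pose D k := \sum_i (\sum_j a i j * V j k) *: Fi i.
have euler : \sum_k l (f k) * D k = m%:R *: F.
  transitivity (\sum_i l i * Fi i).
    under eq_bigr do rewrite mulr_sumr; rewrite exchange_big /=.
    apply: eq_bigr => i _; rewrite [l i]formE mulr_suml.
    under [RHS]eq_bigr do rewrite VE scaler_sumr mulr_suml.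
    rewrite exchange_big /=; apply: eq_bigr => k _.
    rewrite -scalerAr scaler_suml; apply: eq_bigr => j _.
    by rewrite scalerA -scalerAl.
  by under eq_bigr do rewrite -defining_formE;
     rewrite sumr_const card_ord scaler_nat.
have -> : \prod_(k < n) Fi (f k) =
    (m%:R^-1 : K)%:MP * \sum_k D k * \prod_(k' < n | k' != k) Fi (f k').
  apply: (mulfI defining_form_neq0); rewrite mulrCA mulr_sumr.
  have -> : \sum_k F * (D k * \prod_(k' < n | k' != k) Fi (f k')) =
      (\sum_k l (f k) * D k) * \prod_(k < n) Fi (f k).
    rewrite mulr_suml; apply: eq_bigr => k _.
    by rewrite [in RHS](bigD1 k) //= (defining_formE (f k)); ring.
  rewrite euler -scalerAl mul_mpolyC scalerA mulVf ?scale1r //.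
  exact: natr_size_neq0.
have [_ _ JIM] := idJI; apply: JIM; apply: ideal_sum => // k _.
apply: ideal_mul_in; first exact: directional_in.
have -> : n.-1 = #|[pred k' | k' != k]| by rewrite cardC1 card_ord.
by apply: ideal_exp_prod_card => i; apply: fold_in.
Qed.

Lemma n_product (u : seq 'I_m) : size u = n -> JI (\prod_(i <- u) Fi i).
Proof.
have [d] := ubnP (n - #|[set i in u]|); elim: d u => // d IHd u ltd su.
have [uu|] := boolP (uniq u).
  have i0 : 'I_m by exists n; apply: leq_trans n_lt_m; rewrite addn1.
  rewrite (big_nth i0) big_mkord su; apply: (@distinct_product (fun k => nth i0 u k)).
  by move=> k k' /eqP; rewrite nth_uniq ?su // => /eqP/val_inj.
rewrite -(rot_uniq 0) => nuu.
have /existsP[b ltb] : [exists b, (1 < count_mem b u)%N].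
  apply: contraR nuu; rewrite negb_exists rot_uniq => /forallP cu.
  apply/count_mem_uniq => b; have := cu b; rewrite -leqNgt.
  case bu: (b \in u); last by rewrite (count_memPn _) ?bu.
  by move: bu; rewrite -has_pred1 has_count; case: (count _ _) => [|[]].
have bu : b \in u by rewrite -has_pred1 has_count ltnW.
have puw := perm_to_rem bu; set w := rem b u in puw.
have bw : b \in w.
  rewrite -has_pred1 has_count; move: ltb.
  by rewrite (permP puw) /= eqxx.
have Uw : [set i in u] = [set i in w].
  apply/setP => i; rewrite !inE (perm_mem puw) inE.
  by case: eqP => // ->; rewrite bw.
have ltU : (#|[set i in u]| < n)%N.
  have sw : size w = n.-1 by rewrite size_rem // su.
  rewrite Uw cardsE; apply: leq_ltn_trans (card_size _) _.
  by rewrite sw prednK // ltnW // n_gt1.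
have [c cE] := dual_vectors (ltnW ltU).
(* The vector [c b] takes the value 1 on [l b] and 0 on the other forms indexed by [u], so among the
   indices in [u] only [Fi b] survives in this directional derivative. *)
have bE : Fi b = \sum_i (\sum_j a i j * c b j) *: Fi i
    - \sum_(i | i \notin u) (\sum_j a i j * c b j) *: Fi i.
  rewrite [in RHS](bigID (mem u)) /= addrK (bigD1 b) //= cE ?inE // eqxx.
  rewrite scale1r big1 ?addr0 // => i /andP[iu /negPf ib].
  by rewrite cE ?inE // ib scale0r.
have -> : \prod_(i <- u) Fi i = Fi b * \prod_(i <- w) Fi i.
  by rewrite (perm_big _ puw) big_cons.
rewrite bE mulrBl; apply: ideal_subr => //.
  apply: ideal_mul_in; first exact: directional_in.
  have -> : n.-1 = size (map Fi w) by rewrite size_map size_rem // su.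
  rewrite -(big_map Fi predT id); apply: ideal_exp_prod => _ /mapP[i _ ->].
  exact: fold_in.
rewrite mulr_suml; apply: ideal_sum => // i iu.
rewrite -mul_mpolyC -mulrA; have [_ _] := idJI; apply.
(* One copy of [b] is exchanged for the new index [i]; since [b] remains in [w], the number of
   distinct indices goes up by one. *)
have := IHd (i :: w); rewrite big_cons; apply.
  rewrite (_ : [set _ in _] = i |: [set j in u]); last first.
    by rewrite Uw; apply/setP => j; rewrite !inE.
  rewrite cardsU1 inE iu add1n -ltnS; apply: leq_ltn_trans ltd.
  by rewrite ltn_sub2l.
by rewrite /= size_rem // su prednK // ltnW // n_gt1.
Qed.

Lemma gradient_reduction : is_reduction J I.
Proof.
split=> //; first exact: gradient_sub.
exists n.-1 => x; split; last first.
  by apply: ideal_mulS => //; apply: gradient_sub.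
apply: ideal_exp_family_min => // u su; apply: n_product.
by rewrite su prednK // ltnW // n_gt1.
Qed.

(** * Nakayama at the flat of at most [n] hyperplanes *)

Section AwayFromOrigin.
Variables (U : {set 'I_m}) (L : {mpoly K[n]} -> Prop) (s : nat).
Hypotheses (U_gt0 : (0 < #|U|)%N) (leUn : (#|U| <= n)%N).
Hypotheses (idL : is_ideal L) (L_sub : ideal_sub L I).
Hypothesis L_red : ideal_sub (ideal_exp I s.+1) (ideal_mul L (ideal_exp I s)).

Let g := \prod_(i | i \notin U) l i.
(** The ideal of the flat where the forms in [U] vanish. Multiplying by powers of [g] replaces
    localisation away from the other hyperplanes. *)
Let P : {mpoly K[n]} -> Prop := ideal_gen (fun p => exists2 b, b \in U & p = l b).
Let idP : is_ideal P. Proof. exact: ideal_gen_ideal. Qed.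

(* Membership in [L + <Fi k : k in C> + P I]. *)
Let X (C : {set 'I_m}) x := exists p : 'I_m -> {mpoly K[n]},
  (forall k, k \notin C -> P (p k)) /\ L (x + \sum_k p k * Fi k).

Let idX C : is_ideal (X C).
Proof.
have [[P0 PD PM] [L0 LD LM]] := (idP, idL); split.
- exists (fun=> 0); split=> //; rewrite add0r big1 // => k _.
  by rewrite mul0r.
- move=> x y [p [Pp Lp]] [q [Pq Lq]]; exists (fun k => p k + q k).
  split=> [k kC|]; first by apply: PD; [apply: Pp | apply: Pq].
  under eq_bigr do rewrite mulrDl.
  by rewrite big_split addrACA; apply: LD.
- move=> r x [p [Pp Lp]]; exists (fun k => r * p k).
  split=> [k kC|]; first by apply/PM/Pp.
  under eq_bigr do rewrite -mulrA.
  by rewrite -mulr_sumr -mulrDr; apply: LM.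
Qed.

Let X_L C x : L x -> X C x.
Proof.
move=> Lx; exists (fun=> 0); split=> [k _|]; first by case: idP.
by rewrite big1 ?addr0 // => k _; rewrite mul0r.
Qed.

Let X_mul (C : {set 'I_m}) r k : k \in C \/ P r -> X C (r * Fi k).
Proof.
move=> Ckr; exists (fun k' => if k' == k then - r else 0); split=> [k' kC|].
  case: eqP kC => [->|_ _]; last by case: idP.
  by case: Ckr => [->//|Pr _]; apply: ideal_opp.
rewrite (bigD1 k) //= eqxx mulNr addrA subrr add0r big1; first by case: idL.
by move=> k' /negPf->; rewrite mul0r.
Qed.


(** [g * Fi i] is [g / l i] times [F], and [F] is [l b * Fi b]. Thus, up to a factor [g], the
    generators outside [U] lie in [P I]. *)
Let outside_via_inside : exists2 b, b \in U & forall i, i \notin U ->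
  exists r, g * Fi i = (r * l b) * Fi b.
Proof.
case/card_gt0P: U_gt0 => b Ub; exists b => // i Ui.
exists (\prod_(j | (j \notin U) && (j != i)) l j).
rewrite -mulrA -defining_formE /g (bigD1 i) //= (defining_formE i); ring.
Qed.

Let X_outside C i : i \notin U -> X C (g * Fi i).
Proof.
have [b Ub /[apply] -[r ->]] := outside_via_inside; apply: X_mul; right.
by have [_ _] := idP; apply; apply: ideal_gen_incl; exists b.
Qed.

(* In coordinates with [l b], [b \in U], among the variables, the arc sends
   [l b] to [t \prod_(b' != b) (d b' + t)] and fixes the other variables. *)
Lemma away_arc_exists (d : 'I_m -> {mpoly K[n]}) :
  exists phi : {rmorphism {mpoly K[n]} -> {poly {mpoly K[n]}}},
    (forall b, b \in U ->
       phi (l b) = 'X * \prod_(b' in U | b' != b) ((d b')%:P + 'X)) /\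
    (forall r, P (r - (phi r).[0])).
Proof.
have [c c_dual] := dual_vectors leUn.
pose G b : {poly {mpoly K[n]}} := \prod_(b' in U | b' != b) ((d b')%:P + 'X).
(* Moving along the dual vector [c b] changes [l b] alone among the forms in [U]; the amount of the
   move brings [l b] to its prescribed image. *)
pose h j := ('X_j)%:P + \sum_(b in U) const_arc K n (c b j) * ('X * G b - (l b)%:P).
exists (arc h); split=> [i Ui|r].
  rewrite arc_form -/(G i); last by case: l_gen => /(_ i)[].
  have -> : 'X * G i = (l i)%:P + ('X * G i - (l i)%:P) by ring.
  under eq_bigr do rewrite mulrDr; rewrite big_split; congr (_ + _).
    rewrite [in RHS]formE rmorph_sum; apply: eq_bigr => j _.
    by rewrite -mul_mpolyC rmorphM.
  under eq_bigr do rewrite mulr_sumr; rewrite exchange_big (bigD1 i) //=.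
  rewrite [X in _ + X]big1 ?addr0 => [|b /andP[Ub bi]];
    under eq_bigr do rewrite mulrA -(rmorphM (const_arc K n));
    rewrite -mulr_suml -(raddf_sum (const_arc K n)).
    by rewrite c_dual // eqxx rmorph1 mul1r.
  by rewrite c_dual // eq_sym (negPf bi) rmorph0 mul0r.
apply: arc_congr => // j; rewrite hornerD hornerC opprD addrA subrr add0r.
rewrite horner_sum; apply: ideal_opp => //; apply: ideal_sum => // b Ub.
rewrite hornerM hornerD hornerM hornerX mul0r add0r hornerN !hornerC.
have [_ _] := idP; apply; apply: ideal_opp => //.
by apply: ideal_gen_incl; exists b.
Qed.

Section Arc.
Variable d : 'I_m -> {mpoly K[n]}.
Variable phi : {rmorphism {mpoly K[n]} -> {poly {mpoly K[n]}}}.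

(** Every [T b * phi (l b)] with [b] in [U] equals ['X * theta]. So [theta * phi (Fi b)] is [omega]
    times [phi g * T b], and at [t = 0] the generators are told apart by the freely chosen [d b].
    For an index outside [U] one more factor ['X] appears and the value is 0. *)
Let T b : {poly {mpoly K[n]}} := (d b)%:P + 'X.
Let G b : {poly {mpoly K[n]}} := \prod_(b' in U | b' != b) T b'.
Let theta : {poly {mpoly K[n]}} := \prod_(b in U) T b.
Let omega := ('X * theta) ^+ #|U|.-1.

Hypothesis phi_l : forall b, b \in U -> phi (l b) = 'X * G b.
Hypothesis phi_P : forall r, P (r - (phi r).[0]).

Let T_neq0 b : T b != 0.
Proof. by rewrite -size_poly_eq0 /T addrC size_XaddC. Qed.

Let omega_neq0 : omega != 0.
Proof.
rewrite expf_neq0 // mulf_neq0 ?polyX_eq0 //; apply/prodf_neq0 => b _.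
exact: T_neq0.
Qed.

Let T_arc b : b \in U -> T b * phi (l b) = 'X * theta.
Proof. by move=> Ub; rewrite phi_l // mulrCA /theta (bigD1 b). Qed.

Let initial_inside b : b \in U ->
  initial phi theta omega 1 (Fi b) ((phi g).[0] * d b).
Proof.
move=> Ub; exists (phi g * T b); last by rewrite hornerM hornerD hornerC hornerX addr0.
rewrite !expr1 /Fi (bigID (mem U)) rmorphM mulrA.
have -> : \prod_(i | (i != b) && (i \notin U)) l i = g.
  by apply: eq_bigl => i; rewrite andb_idl //; apply: contraNneq => ->.
have -> : theta * phi (\prod_(i | (i != b) && (i \in U)) l i) = T b * omega.
  rewrite /theta (bigD1 b) //= -mulrA rmorph_prod; congr (_ * _).
  under [X in _ * X]eq_bigl do rewrite andbC.
  rewrite -big_split /= (eq_bigr (fun=> 'X * theta)) => [|i /andP[Ui _]].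
    rewrite prodr_const /omega (cardD1 b) Ub; congr (_ ^+ _).
    by apply: eq_card => i; rewrite !inE andbC.
  exact: T_arc.
by ring.
Qed.

Let initial_outside i : i \notin U -> initial phi theta omega 1 (Fi i) 0.
Proof.
move=> Ui; exists (phi (\prod_(j | (j != i) && (j \notin U)) l j) * ('X * theta)).
  rewrite !expr1 /Fi (bigID (mem U)) rmorphM mulrA.
  have -> : theta * phi (\prod_(j | (j != i) && (j \in U)) l j) = omega * ('X * theta).
    rewrite rmorph_prod (eq_bigl (mem U)) => [|j]; last first.
      by rewrite andb_idl //; apply: contraTneq => ->.
    rewrite -big_split /= (eq_bigr (fun=> 'X * theta)) => [|j Uj]; last exact: T_arc.
    by rewrite prodr_const /omega -exprSr prednK.
  by ring.
by rewrite hornerM hornerM hornerX mul0r mulr0.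
Qed.

(** Let [Q] be the colon of [X C] by [Fi b0]. For [y = \sum_i w i * Fi i] in [L], the initial value
    is [\sum_(i in U) w i * g * d i] modulo [P]; multiplied by [Fi b0] it becomes [g ^+ N.+1 * y]
    modulo [X C], hence lies in [X C]. So the initial values of [L] lie in [Q], and
    [initial_reduction] puts a power of the initial value of [Fi b0], which is a power of [g] modulo
    [P], in [Q]. *)
Lemma away_arc C b0 N : b0 \in U -> d b0 = g ^+ N ->
  (forall b, b \in U -> X C (g ^+ N * Fi b - d b * Fi b0)) ->
  X C (g ^+ (N.+1 * s.+1) * Fi b0).
Proof.
move=> Ub0 db0 Xd; pose Q r := X C (r * Fi b0).
have [X0 XD XM] := idX C.
have idQ : is_ideal Q.
  split=> [|x y Qx Qy|r x Qx]; rewrite /Q ?mul0r ?mulrDl -?mulrA //.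
    exact: XD.
  exact: XM.
have PQ r : P r -> Q r by move=> Pr; apply: X_mul; right.
have lead_F i : initial phi theta omega 1 (Fi i)
      (if i \in U then (phi g).[0] * d i else 0).
  by case: ifP => [/initial_inside|/negbT/initial_outside].
have lead_I w : initial phi theta omega 1 (\sum_i w i * Fi i)
    (\sum_(i in U) (phi (w i)).[0] * ((phi g).[0] * d i)).
  rewrite [X in initial _ _ _ _ _ X]big_mkcond.
  apply: initial_sum => i; have := initialZ (w i) (lead_F i).
  by case: ifP; rewrite ?mulr0.
have IE x : I x -> exists w, x = \sum_i w i * Fi i.
  by move/ideal_gen_familyP.
have : Q (((phi g).[0] * d b0) ^+ s.+1).
  apply: (initial_reduction omega_neq0 _ idQ _ L_red (fold_in b0)).
  - by move=> x /IE[w ->]; eexists; apply: lead_I.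
  - move=> y Ly; have [w yE] := IE y (L_sub Ly).
    eexists; last by rewrite yE; apply: lead_I.
    rewrite -[X in Q X](subrK (\sum_(i in U) w i * g * d i)).
    have [_ QD _] := idQ; apply: QD.
      apply/PQ; rewrite -sumrB; apply: ideal_sum => // i _.
      rewrite mulrA -mulrBl; apply: ideal_mulr => //.
      have -> : (phi (w i)).[0] * (phi g).[0] - w i * g =
          - ((phi g).[0] * (w i - (phi (w i)).[0]) + w i * (g - (phi g).[0])) by ring.
      apply: ideal_opp => //; have [_ PD PM] := idP.
      by apply: (PD); apply: (PM); apply: phi_P.
    (* Each [d i * Fi b0] is traded for [g ^+ N * Fi i], and the terms outside [U] are added and
       subtracted to rebuild [y]. *)
    rewrite /Q; have -> : (\sum_(i in U) w i * g * d i) * Fi b0 =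
        g ^+ N.+1 * y - g ^+ N * (\sum_(i | i \notin U) w i * (g * Fi i))
        - \sum_(i in U) (w i * g) * (g ^+ N * Fi i - d i * Fi b0).
      rewrite yE [X in g ^+ N.+1 * X](bigID (mem U)) /= mulrDr mulr_suml.
      have -> : g ^+ N * (\sum_(i | i \notin U) w i * (g * Fi i)) =
          g ^+ N.+1 * \sum_(i | i \notin U) w i * Fi i.
        by rewrite !mulr_sumr; apply: eq_bigr => i _; rewrite exprS; ring.
      rewrite addrK mulr_sumr -sumrB; apply: eq_bigr => i _; rewrite exprS; ring.
    apply: ideal_subr => //; first apply: ideal_subr => //.
    + by apply/XM/X_L.
    + by apply: (XM); apply: ideal_sum => // i Ui; apply/XM/X_outside.
    + by apply: ideal_sum => // i Ui; apply/XM/Xd.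
  - exact: initial_inside.
rewrite db0 => QE; rewrite exprM [g ^+ N.+1]exprS -/(Q _).
rewrite -[X in Q X](subrK (((phi g).[0] * g ^+ N) ^+ s.+1)).
have [_ QD _] := idQ; apply: QD => //; apply: PQ.
apply: ideal_subX => //.
by rewrite -mulrBl; apply: ideal_mulr => //; apply: phi_P.
Qed.

End Arc.

(** The hypothesis makes every [g ^+ N * Fi b] a multiple [d b * Fi b0] modulo [X C]. The arc built
    from these multipliers shows that a power of [g] brings [Fi b0] itself into [X C]. *)
Lemma away_step (C : {set 'I_m}) b0 : b0 \in U -> b0 \notin C ->
  (exists N, forall b, b \in U -> X (b0 |: C) (g ^+ N * Fi b)) ->
  exists N, forall b, b \in U -> X C (g ^+ N * Fi b).
Proof.
move=> Ub0 Cb0 [N XN].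
have [d Xd] : exists d : 'I_m -> {mpoly K[n]}, forall b, b \in U ->
    X C (g ^+ N * Fi b - d b * Fi b0).
  apply: (fin_all_exists (U := fun=> {mpoly K[n]})
    (P := fun b r => b \in U -> X C (g ^+ N * Fi b - r * Fi b0))) => b.
  have [/XN[p [Pp Lp]]|_] := boolP (b \in U); last by exists 0.
  exists (- p b0) => _; exists (fun k => if k == b0 then 0 else p k); split=> [k kC|].
    by case: eqP => [_|/eqP kb0]; [case: idP | apply: Pp; rewrite !inE negb_or kb0].
  move: Lp; rewrite (bigD1 b0) //= [in X in _ -> X](bigD1 b0) //= eqxx mul0r.
  rewrite add0r mulNr opprK addrA.
  by congr L; congr (_ + _); apply: eq_bigr => k /negPf->.
(* The multiplier at [b0] is reset to [g ^+ N], so that the initial value of [Fi b0] is a power of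
   [g] modulo [P]. *)
pose d' b := if b == b0 then g ^+ N else d b.
have Xd' b : b \in U -> X C (g ^+ N * Fi b - d' b * Fi b0).
  rewrite /d'; case: eqP => [->|_]; last exact: Xd.
  by rewrite subrr; case: (idX C).
have [phi [phi_l phi_P]] := away_arc_exists d'.
have Xb0 : X C (g ^+ (N.+1 * s.+1) * Fi b0).
  by apply: (away_arc phi_l phi_P Ub0 _ Xd'); rewrite /d' eqxx.
exists (N.+1 * s.+1 + N)%N => b Ub; have [_ XD XM] := idX C.
rewrite exprD -mulrA -[g ^+ N * Fi b](subrK (d' b * Fi b0)) mulrDr; apply: XD.
  by apply/XM/Xd'.
by rewrite mulrCA; apply: XM.
Qed.

Lemma away_colon : exists k r, P r /\ colon L I (g ^+ k + r).
Proof.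
have [N XN] : exists N, forall b, b \in U -> X set0 (g ^+ N * Fi b).
  (* [C] collects the indices already removed from [U]; with none removed the claim is trivial, and
     [away_step] removes one at a time. *)
  suff H (C : {set 'I_m}) : C \subset U ->
      exists N, forall b, b \in U -> X (U :\: C) (g ^+ N * Fi b).
    by have := H U (subxx U); rewrite setDv.
  elim: {C}#|C| {-2}C (erefl #|C|) => [|k IHk] C cC CU.
    exists 0%N => b Ub; rewrite (cards0_eq cC) setD0; apply: X_mul.
    by left.
  have /card_gt0P[b0 Cb0] : (0 < #|C|)%N by rewrite cC.
  have Ub0 := subsetP CU _ Cb0.
  apply: (away_step Ub0); first by rewrite !inE Cb0.
  have -> : b0 |: (U :\: C) = U :\: (C :\ b0).
    apply/setP => b; rewrite !inE negb_and negbK.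
    by case: eqP => // ->; rewrite Ub0.
  apply: IHk; last by apply: subset_trans CU; apply: subD1set.
  by move: cC; rewrite (cardsD1 b0) Cb0 => -[].
(* The extra factor [g] takes care of the indices outside [U]. *)
have XNi i : X set0 (g ^+ N.+1 * Fi i).
  have [_ _ XM] := idX set0.
  have [Ui|Ui] := boolP (i \in U); first by rewrite exprS -mulrA; apply/XM/XN.
  by rewrite exprSr -mulrA; apply/XM/X_outside.
have [A XA] : exists A : 'I_m -> 'I_m -> {mpoly K[n]}, forall i,
    (forall k, P (A i k)) /\ L (g ^+ N.+1 * Fi i + \sum_k A i k * Fi k).
  apply: (fin_all_exists (U := fun=> 'I_m -> {mpoly K[n]})
    (P := fun i p => (forall k, P (p k)) /\ L (g ^+ N.+1 * Fi i + \sum_k p k * Fi k))) => i.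
  by have [p [Pp Lp]] := XNi i; exists p; split=> // k; apply: Pp; rewrite inE.
have [||r Pr Lr] := @nakayama _ L P m Fi (g ^+ N.+1)
    (\matrix_(i, k) ((g ^+ N.+1) *+ (i == k) + A i k)) idL idP.
- move=> i; have [_] := XA i; congr L.
  under [RHS]eq_bigr do rewrite mxE mulrDl; rewrite big_split; congr (_ + _).
  rewrite (bigD1 i) //= eqxx mulr1n big1 ?addr0 // => k /negPf ki.
  by rewrite eq_sym ki mulr0n mul0r.
- by move=> i k; rewrite mxE addrC addrA addNr add0r; have [PA _] := XA i.
exists (N.+1 * m)%N, r; split=> // x /ideal_gen_familyP[w ->].
rewrite mulr_sumr; apply: ideal_sum => // i _.
by rewrite exprM mulrCA; have [_ _] := idL; apply; apply: Lr.
Qed.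

End AwayFromOrigin.

(** * Nakayama at the origin, by counting initial forms *)

Section AtOrigin.
Variables (L : {mpoly K[n]} -> Prop) (s : nat).
Hypotheses (idL : is_ideal L) (L_sub : ideal_sub L J).
Hypothesis L_red : ideal_sub (ideal_exp I s.+1) (ideal_mul L (ideal_exp I s)).

(** The [Fi (f k)] are [F] divided by independent coordinates [l (f k)]. Multiplying a product of
    [d] of them by all [l (f k) ^+ d] gives [F ^+ d] times a monomial in these coordinates, and
    distinct products give distinct monomials. *)
Lemma fold_products_free (f : 'I_n -> 'I_m) d (c : d.-tuple 'I_n -> K) :
  injective f -> \sum_(t in basis n d) c t *: \prod_(i <- t) Fi (f i) = 0 ->
  forall t, t \in basis n d -> c t = 0.
Proof.
move=> injf c0 t0 bt0; have [V [aV _]] := dual_basis injf.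
pose psi : {rmorphism {mpoly K[n]} -> {mpoly K[n]}} :=
  mmap (@mpolyC n K) (fun j => \sum_k V j k *: 'X_k).
have psiZ r x : psi (r *: x) = r *: psi x by rewrite /= mmapZ mul_mpolyC.
have psi_l k : psi (l (f k)) = 'X_k.
  rewrite formE rmorph_sum.
  under eq_bigr do rewrite psiZ /= mmapX mmap1U scaler_sumr.
  rewrite exchange_big (bigD1 k) //= [X in _ + X]big1 ?addr0 => [|k' k'k];
    under eq_bigr do rewrite scalerA; rewrite -scaler_suml aV.
    by rewrite eqxx scale1r.
  by rewrite eq_sym (negPf k'k) scale0r.
(* The exponent complementary to the multiplicity of [k] in [t]; the subtraction never truncates, so
   it determines the multiplicity. *)
pose co (t : d.-tuple 'I_n) k := (d - count_mem k t)%N.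
have le_count (t : d.-tuple 'I_n) k : (count_mem k t <= d)%N.
  by rewrite -[X in (_ <= X)%N](size_tuple t) count_size.
have prodE (t : d.-tuple 'I_n) : (\prod_(i <- t) Fi (f i)) * \prod_k l (f k) ^+ d =
    F ^+ d * \prod_k l (f k) ^+ co t k.
  have -> : \prod_k l (f k) ^+ d = (\prod_(i <- t) l (f i)) * \prod_k l (f k) ^+ co t k.
    rewrite [X in X * _]prod_seq_count -big_split; apply: eq_bigr => k _.
    by rewrite /= -exprD subnKC.
  rewrite mulrA -big_split /=; congr (_ * _).
  under eq_bigr => i _ do rewrite mulrC -defining_formE.
  by rewrite big_const_seq count_predT size_tuple iter_mulr_1.
have cX : \sum_(t in basis n d) c t *: 'X_[[multinom co t k | k < n]] = 0 :> {mpoly K[n]}.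
  transitivity (psi (\sum_(t in basis n d) c t *: \prod_k l (f k) ^+ co t k)).
    rewrite rmorph_sum; apply: eq_bigr => t _; rewrite psiZ rmorph_prod mpolyXE_id.
    by congr (_ *: _); apply: eq_bigr => k _; rewrite rmorphXn psi_l mnmE.
  rewrite (_ : \sum_(t in _) _ = 0) ?rmorph0 //.
  apply: (mulfI (expf_neq0 d defining_form_neq0)); rewrite mulr0.
  transitivity ((\sum_(t in basis n d) c t *: \prod_(i <- t) Fi (f i)) *
    \prod_k l (f k) ^+ d); last by rewrite c0 mul0r.
  rewrite mulr_suml mulr_sumr.
  by apply: eq_bigr => t _; rewrite -scalerAl prodE scalerAr.
have := congr1 (mcoeff [multinom co t0 k | k < n]) cX.
rewrite mcoeff0 raddf_sum (bigD1 t0) //= mcoeffZ mcoeffX eqxx mulr1.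
rewrite big1 ?addr0 // => t /andP[bt tt0]; rewrite mcoeffZ mcoeffX.
case: eqP => [/mnmP cE|]; last by rewrite mulr0.
case/eqP: tt0; apply: (inj_s2m bt bt0); apply/mnmP => k.
have := cE k; rewrite !mnmE /co => /(congr1 (subn d)).
by rewrite !subKn.
Qed.

(* The arc [t |-> t x] through the origin. *)
Lemma origin_arc_exists :
  exists phi : {rmorphism {mpoly K[n]} -> {poly {mpoly K[n]}}},
    (forall i, phi (l i) = 'X * (l i)%:P) /\
    (forall r, (phi r).[0] = (r.@[fun=> 0])%:MP).
Proof.
exists (arc (fun j => 'X * ('X_j)%:P)); split=> [i|r].
  rewrite arc_form; last by case: l_gen => /(_ i)[].
  rewrite [in RHS]formE rmorph_sum mulr_sumr; apply: eq_bigr => j _.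
  by rewrite -mul_mpolyC rmorphM mulrCA.
by apply: arc_origin => j; rewrite hornerM hornerX mul0r.
Qed.

Let f k := F^`M(k).

Section Arc.
Variable phi : {rmorphism {mpoly K[n]} -> {poly {mpoly K[n]}}}.
Hypothesis phi_l : forall i, phi (l i) = 'X * (l i)%:P.
Hypothesis phi_0 : forall r, (phi r).[0] = (r.@[fun=> 0])%:MP.

Let omega : {poly {mpoly K[n]}} := 'X ^+ m.-1.
Let init := initial phi 1 omega.

Let omega_neq0 : omega != 0.
Proof. by rewrite expf_neq0 // polyX_eq0. Qed.

Let init_scale k r x y : init k x y -> init k (r * x) (r.@[fun=> 0] *: y).
Proof. by move/(initialZ r); rewrite phi_0 mul_mpolyC. Qed.

Let init_fold i : init 1 (Fi i) (Fi i).
Proof.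
exists (Fi i)%:P; last by rewrite hornerC.
rewrite expr1n mul1r expr1 /Fi !rmorph_prod; under eq_bigr do rewrite phi_l.
by rewrite big_split prodr_const cardC1 card_ord.
Qed.

Let init_prod (u : seq 'I_m) : init (size u) (\prod_(i <- u) Fi i) (\prod_(i <- u) Fi i).
Proof.
elim: u => [|i u IHu]; last by rewrite big_cons; apply: (initialM (init_fold i) IHu).
by exists 1; rewrite ?hornerC ?big_nil //= !expr0 rmorph1.
Qed.

Let init_partial k : init 1 (f k) (f k).
Proof.
rewrite /f gradientE; apply: initial_sum => i; rewrite -mul_mpolyC.
by have := init_scale (a i k)%:MP (init_fold i); rewrite mevalC mul_mpolyC.
Qed.

Lemma origin_initial p : init 1 (\sum_k p k * f k) (\sum_k (p k).@[fun=> 0] *: f k).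
Proof. by apply: initial_sum => k; apply/init_scale/init_partial. Qed.

Variable w : 'I_n.-1 -> {mpoly K[n]}.
Hypothesis L_init : forall x, L x -> exists u : 'I_n.-1 -> K, init 1 x (\sum_i u i *: w i).

Let e N (t : N.-tuple 'I_n.-1 * s.-tuple 'I_m) :=
  (\prod_(i <- t.1) w i) * \prod_(i <- t.2) Fi i.
Let A N : {set N.-tuple 'I_n.-1 * s.-tuple 'I_m} := setX (basis n.-1 N) setT.
Arguments e : clear implicits.

(** The reduction equation peels off [N] factors from [L], whose initial forms are combinations of
    the [w i], and leaves a factor in [ideal_exp I s]. Coefficients enter only through their values
    at the origin, so the span is over [K]. *)
Let init_span N x : ideal_exp I (s + N) x ->
  exists2 y, init (s + N) x y & fin_span (A N) (e N) y.
Proof.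
have idQ N' k : is_ideal (fun x => exists2 y, init k x y & fin_span (A N') (e N') y).
  split=> [|x1 x2 [y1 ? ?] [y2 ? ?]|r x1 [y1 ? ?]].
  - by exists 0; [apply: initial0 | apply: fin_span0].
  - by exists (y1 + y2); [apply: initialD | apply: fin_spanD].
  - by exists (r.@[fun=> 0] *: y1); [apply: init_scale | apply: fin_spanZ].
elim: N x => [|N IHN] x.
  rewrite addn0; apply: (ideal_exp_family_min (idQ 0%N s)) => u su.
  exists (\prod_(i <- u) Fi i); first by rewrite -su; apply: init_prod.
  have -> : \prod_(i <- u) Fi i = e 0%N ([tuple], Tuple (introT eqP su)).
    by rewrite /e big_nil mul1r.
  by apply: fin_span_in; rewrite !inE.
rewrite addnS => /(ideal_exp_reduction L_red).
apply: (ideal_gen_min (idQ N.+1 _)) => _ [x1 [x2 [/L_init[u xu] /IHN[y xy [c yE]] ->]]].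
exists ((\sum_i u i *: w i) * y); first exact: (initialM xu xy).
rewrite yE mulr_suml; apply: fin_span_sum => i _; rewrite mulr_sumr.
apply: fin_span_sum => t At; rewrite -scalerAl -scalerAr; do 2!apply: fin_spanZ.
pose r := [rel j j' : 'I_n.-1 | j <= j']%N.
(* Sorting the indices after adding [i] gives the representative of the monomial in [basis]. *)
have -> : w i * e N t = e N.+1 ([tuple of sort r (cons_tuple i t.1)], t.2).
  by rewrite /e /= (perm_big _ (permEl (perm_sort _ _))) big_cons mulrA.
apply: fin_span_in; rewrite !inE andbT /= sorted_map.
by apply: sort_sorted => j j'; apply: leq_total.
Qed.

(* The initial forms of [I^(s + N)] contain those of the monomials of degree
   [s + N] in [n] algebraically independent forms, which are too many to lie in
   the span of finitely many multiples of monomials of degree [N] in [n - 1]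
   forms. *)
Lemma no_smaller_reduction : False.
Proof.
have [f0 [injf0 _]] : exists f0 : 'I_n -> 'I_m, injective f0 /\
    forall i, i \in set0 -> exists k, f0 k = i.
  by apply: injective_extension; rewrite cards0.
(* Monomials of degree [N] in [n.-1] forms number ['C(N + n.-2, N)], and each is multiplied by at
   most one product per [s]-tuple; this fixes the two parameters. *)
have [N] := binomial_growth n.-2 #|{: s.-tuple 'I_m}| s.
have n1E : n.-2.+1 = n.-1 by case: n n_gt1 => [|[]].
rewrite n1E [(N + s)%N]addnC ltnNge => /negP; apply.
rewrite -card_basis; last by apply: ltnW n_gt1.
have -> : ('C(N + n.-2, N) * #|{: s.-tuple 'I_m}|)%N = #|A N|.
  by rewrite /A cardsX cardsT card_basis //; case: n n_gt1 => [|[]].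
apply: (@card_free_le_span K {mpoly K[n]} _ (A N) (e N) _ _
  (fun t : (s + N).-tuple 'I_n => \prod_(i <- t) Fi (f0 i))).
  by move=> c; apply: fold_products_free.
move=> t _; have := init_prod (map f0 t).
rewrite size_map size_tuple big_map => it.
have [|y iy] := @init_span N (\prod_(i <- t) Fi (f0 i)).
  rewrite -[in ideal_exp _ _](size_tuple t) -(size_map (Fi \o f0)).
  rewrite -(big_map (Fi \o f0) predT id); apply: ideal_exp_prod => _ /mapP[i _ ->].
  exact: fold_in.
by rewrite (initial_inj omega_neq0 it iy).
Qed.

End Arc.

(** [W] consists of the constant terms of the coefficient vectors that express elements of [L] in
    the partial derivatives. If [W] is everything, Nakayama at the origin applies with [a = 1];
    otherwise [n.-1] forms span the initial forms of [L], contradicting [no_smaller_reduction]. *)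
Lemma origin_colon : exists r, r.@[fun=> 0] = 0 /\ colon L J (1 + r).
Proof.
pose W (v : 'rV[K]_n) := exists p : 'I_n -> {mpoly K[n]},
  L (\sum_k p k * f k) /\ forall k, (p k).@[fun=> 0] = v 0 k.
have [phi [phi_l phi_0]] := origin_arc_exists.
pose P (r : {mpoly K[n]}) := r.@[fun=> 0] = 0.
have idP : is_ideal P.
  split=> [|x y|c x]; rewrite /P ?meval0 // ?mevalD ?mevalM.
    by move=> -> ->; rewrite addr0.
  by move=> ->; rewrite mulr0.
have [|Wall|[B WB]] := subspace_or_hyperplane (W := W).
- move=> q u A WA.
  have [p Lp] : exists p : 'I_q -> 'I_n -> {mpoly K[n]}, forall i,
      L (\sum_k p i k * f k) /\ forall k, (p i k).@[fun=> 0] = A i k.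
    apply: (fin_all_exists (U := fun=> 'I_n -> {mpoly K[n]}) (P := fun i p =>
      L (\sum_k p k * f k) /\ forall k, (p k).@[fun=> 0] = A i k)) => i.
    by have [p [Lp pA]] := WA i; exists p; split=> // k; rewrite pA mxE.
  exists (fun k => \sum_i (u 0 i)%:MP * p i k); split=> [|k].
    under eq_bigr do rewrite mulr_suml; rewrite exchange_big.
    apply: ideal_sum => // i _; under eq_bigr do rewrite -mulrA.
    by rewrite -mulr_sumr; have [_ _] := idL; apply; have [] := Lp i.
  rewrite raddf_sum mxE; apply: eq_bigr => i _ /=.
  by rewrite mevalM mevalC; have [_ ->] := Lp i.
- have [p Lp] : exists p : 'I_n -> 'I_n -> {mpoly K[n]}, forall i,
      L (\sum_k p i k * f k) /\ forall k, (p i k).@[fun=> 0] = (i == k)%:R.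
    apply: (fin_all_exists (U := fun=> 'I_n -> {mpoly K[n]}) (P := fun i p =>
      L (\sum_k p k * f k) /\ forall k, (p k).@[fun=> 0] = (i == k)%:R)) => i.
    have [p [Lp pA]] := Wall (delta_mx 0 i); exists p; split=> // k.
    by rewrite pA mxE eqxx eq_sym.
  have [||r Pr Lr] := @nakayama _ L P n f 1 (\matrix_(i, k) p i k) idL idP.
  + by move=> i; under eq_bigr do rewrite mxE; have [] := Lp i.
  + move=> i k; rewrite mxE /P mevalB; have [_ ->] := Lp i.
    by rewrite mevalMn meval1 subrr.
  exists r; split=> // x /ideal_gen_familyP[v ->]; rewrite mulr_sumr.
  apply: ideal_sum => // k _; rewrite mulrCA; have [_ _] := idL; apply.
  by have := Lr k; rewrite expr1n.
- exfalso; apply: (no_smaller_reduction phi_l phi_0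
    (w := fun i => \sum_k B i k *: f k)) => x Lx.
  have [p xE] : exists p, x = \sum_k p k * f k by apply/ideal_gen_familyP/L_sub.
  have /WB/submxP[u uE] : W (\row_k (p k).@[fun=> 0]).
    by exists p; split=> [|k]; rewrite -?xE ?mxE.
  exists (fun i => u 0 i); rewrite xE.
  rewrite (_ : \sum_i u 0 i *: _ = \sum_k (p k).@[fun=> 0] *: f k).
    exact: (origin_initial phi_l phi_0).
  under eq_bigr do rewrite scaler_sumr; rewrite exchange_big.
  apply: eq_bigr => k _; under eq_bigr do rewrite scalerA.
  rewrite -scaler_suml; congr (_ *: _).
  by have := congr1 (fun M : 'rV_n => M 0 k) uE; rewrite !mxE.
Qed.

End AtOrigin.


(** * Minimality: induction on sets of hyperplanes *)

Section Minimality.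
Variable L : {mpoly K[n]} -> Prop.
Hypotheses (L_reduction : is_reduction L I) (L_sub : ideal_sub L J).

Let g (U : {set 'I_m}) := \prod_(i | i \notin U) l i.

(* By induction on [U]: the radical of [colon L J] contains [g U * l b] for all
   [b] in [U], and [g U ^+ k + r] for some [r] in the ideal of these [l b]. *)
Lemma rad_colon U : ideal_rad (colon L J) (g U).
Proof.
have [_ idL LI [s red]] := L_reduction.
have L_red : ideal_sub (ideal_exp I s.+1) (ideal_mul L (ideal_exp I s)).
  by move=> x /red.
have idC := colon_ideal J idL; have idR := ideal_rad_ideal idC.
have [_ RD RM] := idR.
elim: {U}#|U| {-2}U (erefl #|U|) => [|c IHc] U cU.
  (* For empty [U], [F] lies in [I], so [F ^+ s.+1] lies in [ideal_mul L (ideal_exp I s)] and hence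
     in [L]. *)
  have -> : g U = F.
    by rewrite (cards0_eq cU); apply: eq_bigl => i; rewrite inE.
  exists s.+1 => x _; apply: ideal_mulr => //.
  apply: (ideal_mul_subl idL); apply/L_red/ideal_exp_expr.
  have m0 : (0 < m)%N by apply: leq_trans n_lt_m; rewrite addn1.
  by rewrite (defining_formE (Ordinal m0)); have [_ _] := idI; apply; apply: fold_in.
have gl b : b \in U -> ideal_rad (colon L J) (g U * l b).
  move=> Ub; have -> : g U * l b = g (U :\ b).
    rewrite /g [RHS](bigD1 b) ?inE ?eqxx //= mulrC; congr (_ * _).
    by apply: eq_bigl => i; rewrite !inE; case: eqP => [->|]; rewrite ?Ub ?andbT.
  by apply: IHc; move: cU; rewrite (cardsD1 b) Ub => -[].
(* By [gl], [g U * r] lies in the radical; subtracting it from [g U * (g U ^+ k + r)] leaves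
   [g U ^+ k.+1]. *)
suff [k [r [Pr Cr]]] : exists k r,
    ideal_gen (fun p => exists2 b, b \in U & p = l b) r /\ colon L J (g U ^+ k + r).
  have gr : ideal_rad (colon L J) (g U * r).
    apply: (ideal_gen_min (P := fun r => ideal_rad (colon L J) (g U * r))) Pr.
      split=> [|x y gx gy|x y gy]; first by rewrite mulr0; case: idR.
        by rewrite mulrDr; apply: RD.
      by rewrite mulrCA; apply: RM.
    by move=> _ [b Ub ->]; apply: gl.
  apply: (@ideal_rad_expr _ _ _ k.+1).
  have -> : g U ^+ k.+1 = g U * (g U ^+ k + r) - g U * r by rewrite exprS; ring.
  by apply: (ideal_subr idR _ gr); apply: (RM); apply: ideal_rad_incl Cr.
have [leUn|ltnU] := leqP #|U| n.
  have U_gt0 : (0 < #|U|)%N by rewrite cU.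
  have [k [r [Pr Cr]]] := away_colon U_gt0 leUn idL LI L_red.
  by exists k, r; split=> // x Jx; apply/Cr/gradient_sub.
have [r [r0 Cr]] := origin_colon idL L_sub L_red.
(* More than [n] forms generate all the variables, so [r], which vanishes at the origin, lies in
   their ideal; the constant arc at the origin expresses this. *)
exists 0%N, r; split; last by rewrite expr0.
set P := ideal_gen _; have idP : is_ideal P by apply: ideal_gen_ideal.
have PX j : P ('X_j).
  have [c' ->] := span_forms j (ltnW ltnU).
  apply: ideal_sum => // i Ui; rewrite -mul_mpolyC.
  by have [_ _] := idP; apply; apply: ideal_gen_incl; exists i.
rewrite -[r]subr0 -[X in _ - X]mpolyC0 -r0 -(arc_origin (h := fun=> 0)) => [|j].
  by apply: arc_congr => // j; rewrite horner0 subr0.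
by rewrite horner0.
Qed.

Lemma sub_reduction_eq : ideal_eq L J.
Proof.
have [_ idL _ _] := L_reduction; move=> x; split=> [|Jx]; first exact: L_sub.
(* For [U] the set of all hyperplanes, [g U] is an empty product, so the colon ideal contains 1. *)
have [N] := rad_colon setT; rewrite /g big1 ?expr1n => [/(_ x Jx)|i].
  by rewrite mul1r.
by rewrite inE.
Qed.

End Minimality.

Lemma gradient_minimal_reduction : is_minimal_reduction J I.
Proof.
split; first exact: gradient_reduction.
by move=> L redL subL; apply: sub_reduction_eq.
Qed.

End GenericArrangement.

Theorem theorem2p5 (K : fieldType) (n m : nat) (l : 'I_m -> {mpoly K[n]})
    (K_inf : infinite_type K)
    (n_lt_m : (n + 1 <= m)%N)
    (l_gen : generic_arrangement l)
    (char_ndvd_m : forall p : nat, p \in [pchar K] -> ~~ (p %| m)%N) :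
  is_minimal_reduction (gradient_ideal (defining_form l))
                       (fold_products_ideal l).
Proof. exact: gradient_minimal_reduction. Qed.
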